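(* There exists an absolute constant $c > 0$ such that for every integer $N \geq 1$, \[ \sup_{f \neq 0} \frac{\| f^{**} \|_{L^{1,\infty}(\{0,1\}^N)}}{\| f \|_{L^1(\{0,1\}^N)}} \;\geq\; \frac{\| \delta^{**} \|_{L^{1,\infty}(\{0,1\}^N)}}{\| \delta \|_{L^1(\{0,1\}^N)}} \;\geq\; c \sqrt{N}, \] where the supremum is over all non-zero functions $f : \{0,1\}^N \to \mathbb{C}$, $\delta = \mathbf{1}_{\{(0,\dots,0)\}}$ is the point mass at the origin, and $f^{**}(x) := \sup_{0 \leq k \leq N} |\sigma_k * f(x)|$.
   Context: $\mathbb{I}^N = \{0,1\}^N$ is the $N$-dimensional hypercube, viewed as the group $(\mathbb{Z}/2\mathbb{Z})^N$ (addition and subtraction are componentwise mod 2). For $y \in \mathbb{I}^N$, $|y| := \#\{1 \leq i \leq N : y(i) = 1\}$. For an integer $0 \leq k \leq N$, $\sigma_k := \binom{N}{k}^{-1} \mathbf{1}_{\{x \in \mathbb{I}^N : |x| = k\}}$, and $\sigma_k * f(x) := \sum_{y \in \mathbb{I}^N} f(x-y)\sigma_k(y)$. Norms are with respect to counting measure: $\|f\|_{L^1(\mathbb{I}^N)} := \sum_{x \in \mathbb{I}^N} |f(x)|$ and the weak-type quasi-norm is $\|g\|_{L^{1,\infty}(\mathbb{I}^N)} := \sup_{\lambda > 0} \lambda \cdot |\{x \in \mathbb{I}^N : |g(x)| > \lambda\}|$. *)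

(* Defs.v *)
From HB Require Import structures.
From mathcomp Require Import all_boot all_order all_algebra.
From mathcomp Require Import all_classical all_reals all_analysis.
From mathcomp Require Import complex.

Set Implicit Arguments.
Unset Strict Implicit.
Unset Printing Implicit Defensive.

Import Order.TTheory GRing.Theory Num.Theory.

Local Open Scope classical_set_scope.
Local Open Scope ring_scope.

(* The hypercube {0,1}^N as the additive group (Z/2Z)^N. *)
Definition cube (N : nat) := 'rV['Z_2]_N.

Definition weight (N : nat) (x : cube N) : nat := #|[set i : 'I_N | x 0%R i == 1%R]%SET|.

Definition sphere_avg (R : realType) (N k : nat) (x : cube N) : R[i] :=
  ('C(N, k)%:R)^-1 * (weight x == k)%:R.

Definition convol (R : realType) (N : nat) (g f : cube N -> R[i]) (x : cube N) : R[i] :=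
  \sum_(y : cube N) f (x - y) * g y.

Definition cmod (R : realType) (z : R[i]) : R := ComplexField.Normc.normc z.

(* Taking 0 as the default value of the maximum is harmless: the index set is
   nonempty and the moduli are nonnegative. *)
Definition sphere_max (R : realType) (N : nat) (f : cube N -> R[i]) (x : cube N) : R :=
  \big[Num.max/0]_(k < N.+1) cmod (convol (@sphere_avg R N k) f x).

Definition norm_L1 (R : realType) (N : nat) (f : cube N -> R[i]) : R :=
  \sum_(x : cube N) cmod (f x).

Definition norm_weakL1 (R : realType) (N : nat) (g : cube N -> R) : \bar R :=
  ereal_sup [set (l * #|[set x : cube N | (l < `|g x|)%R]%SET|%:R)%:E
            | l in [set l : R | 0 < l]].

Definition delta0 (R : realType) (N : nat) (x : cube N) : R[i] := (x == 0)%:R.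

(* For f <> 0 the denominator is a positive real, so the extended-real
   division is the ordinary one. *)
Definition weak_ratio (R : realType) (N : nat) (f : cube N -> R[i]) : \bar R :=
  (norm_weakL1 (sphere_max f) / (norm_L1 f)%:E)%E.

(* Main.v *)
Require Import Defs.
From mathcomp Require Import all_boot all_order all_algebra.
From mathcomp Require Import all_classical all_reals all_analysis.
From mathcomp Require Import complex.
From mathcomp Require Import zify ring.

Import Order.TTheory GRing.Theory Num.Theory.
Local Open Scope classical_set_scope.
Local Open Scope ring_scope.

(** The maximal function of the point mass is [1 / C(N, |x|)], because only the
    sphere of radius [|x|] sees the origin from [x].  Every binomial coefficient
    satisfies [C(N, k)^2 (N + 1) <= 4^N], so at the level
    [l = sqrt N / 2^(N + 1)] the superlevel set is the whole cube, and
    [l * 2^N = sqrt N / 2]. *)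

Lemma leq_bin_succ (n k : nat) : (k.*2 < n)%N -> ('C(n, k) <= 'C(n, k.+1))%N.
Proof.
move=> hk; have h := mul_bin_left n k.
rewrite -(@leq_pmul2l k.+1) // h leq_mul2r; apply/orP; right; lia.
Qed.

(** The symmetry of row [n] moves [k] to the lower half, where the row increases; the induction is
    on the distance [d] below the middle. *)
Lemma leq_bin_half (n k : nat) : ('C(n, k) <= 'C(n, n./2))%N.
Proof.
suff low j : (j <= n./2)%N -> ('C(n, j) <= 'C(n, n./2))%N.
  have [/low //|hk] := leqP k n./2.
  have [hkn|hkn] := leqP k n; last by rewrite bin_small.
  by rewrite -bin_sub //; apply: low; lia.
move=> hj; rewrite -(subKn hj).
elim: (n./2 - j)%N (leq_subr j n./2) => [|d IH] hd; first by rewrite subn0.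
apply: leq_trans (IH (ltnW hd)).
rewrite (_ : n./2 - d = (n./2 - d.+1).+1)%N; last by lia.
by apply: leq_bin_succ; lia.
Qed.

Lemma bin_central_double (m : nat) :
  'C(m.+1.*2, m.+1) = ('C(m.*2.+1, m)).*2.
Proof.
have := mul_bin_diag m.+1.*2 m; rewrite doubleS /= => h.
apply/eqP; rewrite -(@eqn_pmul2l m.+1) // -h; apply/eqP; lia.
Qed.

(** Since C(2m+2, m+1) = 2 (2m+1)/(m+1) C(2m, m), passing from m to m+1 multiplies the left side by
    4 (2m+1)(2m+3)/(m+1)^2. This is at most 16 because (2m+1)(2m+3) < (2m+2)^2. *)
Lemma bin_central_sqr (m : nat) : ('C(m.*2, m) ^ 2 * m.*2.+1 <= 16 ^ m)%N.
Proof.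
elim: m => [//|m IH].
rewrite bin_central_double (expnS 16).
have h := mul_bin_down m.*2.+1 m.
have {}h : (m.*2.+1 * 'C(m.*2, m) = m.+1 * 'C(m.*2.+1, m))%N.
  by rewrite /= in h; rewrite h; congr (_ * _)%N; rewrite -addnn -addSn addnK.
(* The factor (m+1)^2 clears the denominator of that ratio, so the argument stays in [nat]. *)
rewrite -(@leq_pmul2l (m.+1 ^ 2)) //.
move: h IH; set b := 'C(_, _); set a := 'C(_, _); set p := (16 ^ m)%N => h IH.
have -> : (m.+1 ^ 2 * (a.*2 ^ 2 * (m.+1).*2.+1)
           = 4 * (m.*2.+1 * b) ^ 2 * (m.+1).*2.+1)%N
  by rewrite h -!mulnn -muln2; ring.
have h2 : (m.*2.+1 * (m.+1).*2.+1 <= 4 * m.+1 ^ 2)%N by nia.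
have -> : (4 * (m.*2.+1 * b) ^ 2 * (m.+1).*2.+1
           = 4 * ((b ^ 2 * m.*2.+1) * (m.*2.+1 * (m.+1).*2.+1)))%N
  by rewrite -!mulnn; ring.
have -> : (m.+1 ^ 2 * (16 * p) = 4 * (p * (4 * m.+1 ^ 2)))%N.
  by rewrite -!mulnn; ring.
by rewrite leq_mul2l leq_mul.
Qed.

Lemma bin_sqr_leq (n k : nat) : ('C(n, k) ^ 2 * n.+1 <= 4 ^ n)%N.
Proof.
apply: (@leq_trans ('C(n, n./2) ^ 2 * n.+1)).
  by rewrite leq_mul2r leq_exp2r // leq_bin_half orbT.
have p16 m : (4 ^ m.*2 = 16 ^ m)%N by rewrite -mul2n expnM.
(* The occurrence inside [n./2] is left alone: it serves as m in n = 2m or n = 2m+1. *)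
rewrite -{1 3 4}(odd_double_half n); case: (odd n) => /=; last first.
  by rewrite add0n p16 bin_central_sqr.
rewrite add1n (expnS 4) p16.
(* For n = 2m+1, the even bound at m+1 reads 4 C(n, m)^2 (n+2) <= 16 * 16^m, and 4 * 16^m = 4^n. *)
have := bin_central_sqr n./2.+1; rewrite bin_central_double (expnS 16) doubleS.
nia.
Qed.

Section PointMass.
Variables (R : realType) (N : nat).
Implicit Type x : cube N.

Lemma cmod_nat (n : nat) : cmod (n%:R : R[i]) = n%:R.
Proof. by rewrite /cmod normcMn ComplexField.Normc.normc1. Qed.

Lemma convol_delta0 (g : cube N -> R[i]) x : convol g (@delta0 R N) x = g x.
Proof.
rewrite /convol (bigD1 x) //= /delta0 subrr eqxx mul1r big1 ?addr0 // => y yx.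
by rewrite subr_eq0 eq_sym (negPf yx) mul0r.
Qed.

Lemma norm_L1_delta0 : norm_L1 (@delta0 R N) = 1.
Proof.
rewrite /norm_L1 (bigD1 (0 : cube N)) //= big1 ?addr0 /delta0 => [|y /negPf ->].
  by rewrite eqxx cmod_nat.
exact: cmod_nat.
Qed.

Lemma sphere_max_delta0_ge x :
  ('C(N, weight x)%:R)^-1 <= sphere_max (@delta0 R N) x.
Proof.
have hw : (weight x < N.+1)%N.
  by rewrite ltnS -[leqRHS](card_ord N) max_card.
apply: le_trans (le_bigmax _ _ (Ordinal hw)).
by rewrite convol_delta0 /sphere_avg /= eqxx mulr1 /cmod
  ComplexField.Normc.normcV -/(cmod _) cmod_nat.
Qed.

Lemma card_cube : #|{: cube N}| = (2 ^ N)%N.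
Proof. by rewrite card_mx mul1n card_ord. Qed.

Lemma sphere_max_delta0_gt x : (0 < N)%N ->
  Num.sqrt N%:R / 2 ^+ N.+1 < sphere_max (@delta0 R N) x.
Proof.
move=> N0; apply: lt_le_trans (sphere_max_delta0_ge x).
set k := weight x.
have k0 : (0 < 'C(N, k))%N.
  by rewrite bin_gt0 -[leqRHS](card_ord N) max_card.
rewrite ltr_pdivrMr ?exprn_gt0 // mulrC ltr_pdivlMr ?ltr0n //.
rewrite -(@ltr_pXn2r _ 2) ?nnegrE ?mulr_ge0 ?sqrtr_ge0 ?ler0n ?exprn_ge0 //.
rewrite exprMn sqr_sqrtr ?ler0n // -!natrX -natrM ltr_nat.
rewrite -expnM [(_.+1 * 2)%N]mulnC expnM (expnS (2 ^ 2)).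
(* After squaring, the exponent [N.+1] in the level leaves a spare factor 4, which gives the strict
   inequality that a superlevel set asks for. *)
apply: (@leq_ltn_trans (4 ^ N)); last by rewrite ltn_Pmull // expn_gt0.
by apply: leq_trans (bin_sqr_leq N k); rewrite mulnC leq_mul.
Qed.

Lemma norm_weakL1_delta0_ge : (0 < N)%N ->
  ((2^-1 * Num.sqrt N%:R)%:E <= norm_weakL1 (sphere_max (@delta0 R N)))%E.
Proof.
move=> N0; apply: ereal_sup_ubound; exists (Num.sqrt N%:R / 2 ^+ N.+1).
  by rewrite /= divr_gt0 ?exprn_gt0 // sqrtr_gt0 ltr0n.
congr (_%:E).
have -> : [set x : cube N | Num.sqrt N%:R / 2 ^+ N.+1 <
     `|sphere_max (@delta0 R N) x| ]%SET = [set: cube N]%SET.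
  apply/setP => x; rewrite !inE.
  exact: lt_le_trans (sphere_max_delta0_gt x N0) (ler_norm _).
by rewrite cardsT card_cube natrX exprS invfM mulrA divfK ?expf_neq0 // mulrC.
Qed.

End PointMass.

Theorem mainTheorem2 (R : realType) :
  exists c : R, 0 < c /\
    forall N : nat, (1 <= N)%N ->
      (weak_ratio (@delta0 R N) <=
         ereal_sup [set weak_ratio f | f in [set f : cube N -> R[i] | f <> (fun=> 0%R)]])%E
      /\
      ((c * Num.sqrt N%:R)%:E <= weak_ratio (@delta0 R N))%E.
Proof.
exists 2^-1; split; first by rewrite invr_gt0.
move=> N N0; split.
  apply: ereal_sup_ubound; exists (@delta0 R N) => //= /(congr1 (@^~ 0)).
  by rewrite /delta0 eqxx => /eqP; rewrite oner_eq0.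
(* The point mass has norm 1, so its ratio is its weak norm. *)
by rewrite /weak_ratio norm_L1_delta0 inve1 mule1 norm_weakL1_delta0_ge.
Qed.
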